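(* A closed set $\Gamma\subset\mathbb{C}^n$ is a set of tangential approximation by entire functions if and only if each of the projections $\Gamma\to\mathbb{R}$, $z=(z_1,\ldots,z_n)\mapsto\Re(z_m)$, $m=1,\ldots,n$, can be tangentially approximated on $\Gamma$ by entire functions.
   Context: Let $\Gamma\subset\mathbb{C}^n$ be closed, and let $\mathcal{C}(\Gamma)$ be the set of continuous complex-valued functions on $\Gamma$. A function $f$ on $\Gamma$ can be tangentially approximated by entire functions if for each positive continuous function $\epsilon$ on $\Gamma$ there is an entire function $g$ on $\mathbb{C}^n$ (i.e. $g$ holomorphic on all of $\mathbb{C}^n$) such that $|f-g|<\epsilon$ on $\Gamma$. The set $\Gamma$ is a set of tangential approximation by entire functions if every $f\in\mathcal{C}(\Gamma)$ can be tangentially approximated by entire functions. *)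

(* Defs.v *)
(* C is R[i], and C^n is the space of row vectors over the normed module R[i]^o,
   so that `differentiable` is C-linear Frechet differentiability. *)
From HB Require Import structures.
From mathcomp Require Import all_boot all_order all_algebra.
From mathcomp Require Import complex.
From mathcomp Require Import classical_sets reals topology normedtype derive.
Set Implicit Arguments.
Unset Strict Implicit.
Unset Printing Implicit Defensive.
Import Order.TTheory GRing.Theory Num.Theory.
Import numFieldNormedType.Exports.
Local Open Scope classical_set_scope.
Local Open Scope ring_scope.
Local Open Scope complex_scope.

Definition entire (R : realType) (n : nat) (g : 'rV[R[i]^o]_n -> R[i]^o) : Prop :=
  forall z : 'rV[R[i]^o]_n, differentiable g z.

(* Functions on G are represented by total functions; only their restrictions
   to G matter, and `{within G, continuous _}` is continuity on G for the
   subspace topology.  The strict inequality is the order of R[i], in which both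
   sides are real. *)
Definition tangentially_approximable (R : realType) (n : nat)
    (G : set 'rV[R[i]^o]_n) (f : 'rV[R[i]^o]_n -> R[i]^o) : Prop :=
  forall eps : 'rV[R[i]^o]_n -> R,
    {within G, continuous eps} ->
    (forall z, G z -> 0 < eps z) ->
    exists2 g : 'rV[R[i]^o]_n -> R[i]^o,
      entire g & forall z, G z -> `|f z - g z| < (eps z)%:C.

Definition tangential_approximation_set (R : realType) (n : nat)
    (G : set 'rV[R[i]^o]_n) : Prop :=
  forall f : 'rV[R[i]^o]_n -> R[i]^o,
    {within G, continuous f} -> tangentially_approximable G f.

(* Main.v *)
Require Import Defs.
From HB Require Import structures.
From mathcomp Require Import all_boot all_order all_algebra.
From mathcomp Require Import complex ring lra finmap interval_inference.
From mathcomp Require Import boolp functions.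
From mathcomp Require Import classical_sets reals topology normedtype derive.
From mathcomp Require Import sequences landau.
Import numFieldNormedType.Exports.
Import Order.TTheory GRing.Theory Num.Theory ComplexField.Normc.
Local Open Scope classical_set_scope.
Local Open Scope ring_scope.
Local Open Scope complex_scope.
Set Implicit Arguments.
Unset Strict Implicit.
Unset Printing Implicit Defensive.

(** One direction is clear, since [Re z_m] is continuous. For the other, identify
    [C^n] with [R^(2n)]. Scheinberg's theorem ([carleman_real] below), for a
    closed subset [S] of [R^N] lying in [C^N], approximates the given function by
    [F (Re z, Im z)] with [F] entire on [C^(2n)]. If [g_m] is entire and very close
    to [Re z_m] on [G], then [- i (z_m - g_m)] is equally close to [Im z_m],
    and so [F (g, - i (z - g))] is entire on [C^n] and close to [F (Re z, Im z)].
    How close [g_m] has to be at [z] is dictated by a positive continuous function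
    of [z] ([stability_radius]).

    Scheinberg's theorem is proved with polynomials only. Exhaust [S] by compact
    slices [|x|^2 <= a_j]. Given a polynomial [F_j] close to [f] on the [j]-th
    slice, choose by density a polynomial [p] close to [f - F_j] on the next one
    and put [F_(j+1) = F_j + u p], where [u] is the cutoff
    [1 - (1 - t^m)^(k^m)] with [t] a multiple of [z . z] ([step], the polynomials
    of Brosowski and Deutsch). On the next slice [u] takes its values in [[0, 1]], so
    the new error is a convex combination of the old one and of the error of [p]:
    nothing is lost on the old slice, and on the new shell [u] is nearly 1. For
    complex [t] with [|k t| <= 1/2] the cutoff is at most [2^(1-m)], so that the
    sequence converges locally uniformly on [C^N] ([carleman_step]).

    That the limit is entire does not rest on Cauchy's formula. All the
    polynomials carry a bound on their value, gradient, increments and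
    second-order Taylor remainders on a polydisc ([jet_bounded]); suitably
    normalised, this bound is submultiplicative, so that the algebra which makes
    [u] small makes its derivative small as well, and it passes to pointwise limits.
    Density on a compact set ([tame_dense]) uses the same cutoffs, centred at the
    points of a finite net, to interpolate between the values of [f] there. *)

(** * The real-valued modulus of a complex number *)

Section Modulus.
Variable R : realType.
Implicit Types x y : R[i].

Lemma normc_ge0 x : 0 <= normc x.
Proof. by case: x => a b; exact: sqrtr_ge0. Qed.

Lemma normr_normc x : `|x| = (normc x)%:C.
Proof. by []. Qed.

Lemma normcR (a : R) : normc a%:C = `|a|.
Proof. by rewrite /= expr0n addr0 sqrtr_sqr. Qed.

Lemma normcD x y : normc (x + y) <= normc x + normc y.
Proof. exact: le_normcD. Qed.

Lemma normcB x y : normc (x - y) <= normc x + normc y.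
Proof. by rewrite -(normcN y); exact: normcD. Qed.

Lemma normcC x y : normc (x - y) = normc (y - x).
Proof. by rewrite -(normcN (x - y)) opprB. Qed.

Lemma normc_tri z x y : normc (x - y) <= normc (x - z) + normc (z - y).
Proof.
have -> : x - y = (x - z) + (z - y).
  ring.
exact: normcD.
Qed.

Lemma normc_sum (I : Type) (s : seq I) (P : pred I) (F : I -> R[i]) :
  normc (\sum_(i <- s | P i) F i) <= \sum_(i <- s | P i) normc (F i).
Proof.
elim/big_rec2: _ => [|i a x _ h]; first by rewrite normc0.
by apply: le_trans (normcD _ _) _; rewrite lerD2l.
Qed.

Lemma normc_Re_Im x : normc x <= `|complex.Re x| + `|complex.Im x|.
Proof.
case: x => a b /=; rewrite -(@ger0_norm _ (`|a| + `|b|)) ?addr_ge0 //.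
rewrite -sqrtr_sqr ler_wsqrtr // sqrrD !real_normK ?num_real //.
by have := normr_ge0 a; have := normr_ge0 b; nra.
Qed.

Lemma Re_le_normc x : `|complex.Re x| <= normc x.
Proof. by rewrite -lecR; exact: normc_ge_Re. Qed.

Lemma Im_le_normc x : `|complex.Im x| <= normc x.
Proof.
case: x => a b /=; rewrite -sqrtr_sqr ler_wsqrtr //.
by have := sqr_ge0 a; nra.
Qed.

End Modulus.
#[local] Hint Resolve normc_ge0 : core.

(** * Polydisc bounds on value, gradient and Taylor remainder *)

Section Jets.
Variables (R : realType) (N : nat).
Local Notation Y := 'rV[R[i]^o]_N.
Implicit Types (F G : Y -> R[i]) (D E : Y -> Y) (z w : Y).

Definition polydisc (r : R) z := forall i, normc (z ord0 i) <= r.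

Definition pairing z w : R[i] := \sum_i z ord0 i * w ord0 i.

(** The factor 3 makes [M] submultiplicative ([jet_sizeM]): the Taylor remainder of a
    product is a sum of three products, each bounded by the product of the two
    bounds. Polydiscs and moduli with values in [R], rather than norms
    with values in [R[i]], keep all the estimates in a totally ordered field. *)
Record jet_bounded (r M : R) F D : Prop := JetBounded {
  jet_value : forall z, polydisc r z -> 3 * normc (F z) <= M;
  jet_gradient : forall z, polydisc r z -> polydisc (M / 3) (D z);
  jet_lipschitz : forall z w d, polydisc r z -> polydisc r w -> 0 <= d ->
    polydisc d (w - z) -> 3 * normc (F w - F z) <= M * d;
  jet_remainder : forall z w d, polydisc r z -> polydisc r w -> 0 <= d ->
    polydisc d (w - z) ->
    3 * normc (F w - F z - pairing (D z) (w - z)) <= M * d ^+ 2 }.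

Definition jet_size r M F := exists D, jet_bounded r M F D.

Lemma polydisc0 r : 0 <= r -> polydisc r 0.
Proof. by move=> r0 i; rewrite mxE normc0. Qed.

Lemma polydisc_le r s z : r <= s -> polydisc r z -> polydisc s z.
Proof. by move=> rs zr i; exact: le_trans (zr i) rs. Qed.

Lemma pairingDl z z' w : pairing (z + z') w = pairing z w + pairing z' w.
Proof. by rewrite -big_split; apply: eq_bigr => i _; rewrite mxE mulrDl. Qed.

Lemma pairingDr z w w' : pairing z (w + w') = pairing z w + pairing z w'.
Proof. by rewrite -big_split; apply: eq_bigr => i _; rewrite mxE mulrDr. Qed.

Lemma pairingZl (c : R[i]) z w : pairing (c *: z) w = c * pairing z w.
Proof. by rewrite mulr_sumr; apply: eq_bigr => i _; rewrite mxE mulrA. Qed.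

Lemma pairingZr (c : R[i]) z w : pairing z (c *: w) = c * pairing z w.
Proof. by rewrite mulr_sumr; apply: eq_bigr => i _; rewrite mxE mulrCA. Qed.

Lemma pairing0 w : pairing 0 w = 0.
Proof. by apply: big1 => i _; rewrite mxE mul0r. Qed.

Lemma jet_bounded_le r M M' F D : M <= M' ->
  jet_bounded r M F D -> jet_bounded r M' F D.
Proof.
move=> MM' [h1 h2 h3 h4]; split.
- by move=> z /h1; lra.
- by move=> z /h2; apply: polydisc_le; lra.
- by move=> z w d hz hw d0 hd; apply: le_trans (h3 _ _ _ hz hw d0 hd) _; nra.
- move=> z w d hz hw d0 hd; apply: le_trans (h4 _ _ _ hz hw d0 hd) _.
  by rewrite ler_wpM2r // sqr_ge0.
Qed.

Lemma jet_size_le r M M' F : M <= M' -> jet_size r M F -> jet_size r M' F.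
Proof. by move=> MM' [D h]; exists D; exact: jet_bounded_le h. Qed.

Lemma jet_size_radius r s M F : r <= s -> jet_size s M F -> jet_size r M F.
Proof.
move=> rs [D [h1 h2 h3 h4]]; exists D.
split=> [z hz|z hz|z w d hz hw|z w d hz hw].
- exact: h1 (polydisc_le rs hz).
- exact: h2 (polydisc_le rs hz).
- exact: h3 (polydisc_le rs hz) (polydisc_le rs hw).
- exact: h4 (polydisc_le rs hz) (polydisc_le rs hw).
Qed.

Lemma jet_size_ge0 r M F : 0 <= r -> jet_size r M F -> 0 <= M.
Proof.
move=> r0 [D [/(_ 0 (polydisc0 r0)) h _ _ _]].
by apply: le_trans h; rewrite mulr_ge0.
Qed.

Lemma jet_size_const r (c : R[i]) : jet_size r (3 * normc c) (fun=> c).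
Proof.
have c0 := normc_ge0 c.
exists (fun=> 0); split => [//|z _ i|z w d _ _ d0 _|z w d _ _ d0 _].
- by rewrite mxE normc0 divr_ge0 // mulr_ge0.
- by rewrite subrr normc0; nra.
- by rewrite subrr pairing0 subrr normc0 mulr0 mulr_ge0 ?sqr_ge0 ?mulr_ge0.
Qed.

Lemma jet_size_coord r (i : 'I_N) : 1 <= r ->
  jet_size r (3 * r) (fun z => z ord0 i).
Proof.
move=> r1; exists (fun=> delta_mx ord0 i).
have Dd z : pairing (delta_mx ord0 i) z = z ord0 i.
  rewrite /pairing (bigD1 i) //= big1 ?addr0 ?mxE ?eqxx ?mul1r // => j ji.
  by rewrite mxE eqxx /= (negPf ji) mul0r.
split => [z hz|z _ j|z w d _ _ d0 hd|z w d _ _ d0 hd].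
- by have := hz i; lra.
- rewrite mxE eqxx /=; case: (j == i); rewrite ?normc1 ?normc0; lra.
- by have := hd i; rewrite !mxE; nra.
- rewrite Dd !mxE subrr normc0 mulr0 mulr_ge0 ?sqr_ge0 //; lra.
Qed.

Lemma jet_boundedD r M1 M2 F G D E : jet_bounded r M1 F D ->
  jet_bounded r M2 G E ->
  jet_bounded r (M1 + M2) (fun z => F z + G z) (fun z => D z + E z).
Proof.
move=> [a1 a2 a3 a4] [b1 b2 b3 b4]; split => [z hz|z hz i|z w d hz hw d0 hd|
  z w d hz hw d0 hd].
- have := a1 _ hz; have := b1 _ hz; have := normcD (F z) (G z); lra.
- rewrite mxE; have := a2 _ hz i; have := b2 _ hz i.
  have := normcD (D z ord0 i) (E z ord0 i); lra.
- have := a3 _ _ _ hz hw d0 hd; have := b3 _ _ _ hz hw d0 hd.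
  have -> : F w + G w - (F z + G z) = (F w - F z) + (G w - G z) by ring.
  have := normcD (F w - F z) (G w - G z); lra.
- have := a4 _ _ _ hz hw d0 hd; have := b4 _ _ _ hz hw d0 hd.
  rewrite pairingDl; set p := pairing (D z) _; set q := pairing (E z) _.
  have -> : F w + G w - (F z + G z) - (p + q) =
    (F w - F z - p) + (G w - G z - q) by ring.
  have := normcD (F w - F z - p) (G w - G z - q); lra.
Qed.

Lemma jet_sizeD r M1 M2 F G : jet_size r M1 F -> jet_size r M2 G ->
  jet_size r (M1 + M2) (fun z => F z + G z).
Proof.
by move=> [D h] [E k]; exists (fun z => D z + E z); exact: jet_boundedD.
Qed.

(** The remainder of [F G] is [F(z) Rem G + Rem F G(z) + Inc F Inc G], where [Rem] and
    [Inc] are the remainder and the increment from [z] to [w]. *)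
Lemma jet_sizeM r M1 M2 F G : jet_size r M1 F -> jet_size r M2 G ->
  jet_size r (M1 * M2) (fun z => F z * G z).
Proof.
move=> [D [a1 a2 a3 a4]] [E [b1 b2 b3 b4]].
have mul3 (x y : R[i]) (A B : R) : 3 * normc x <= A -> 3 * normc y <= B ->
    9 * normc (x * y) <= A * B.
  move=> xA yB; rewrite normcM; have := normc_ge0 x; have := normc_ge0 y => y0 x0.
  have -> : 9 * (normc x * normc y) = (3 * normc x) * (3 * normc y) by ring.
  by apply: ler_pM => //; lra.
exists (fun z => F z *: E z + G z *: D z); split => [z hz|z hz i|
  z w d hz hw d0 hd|z w d hz hw d0 hd].
- have := mul3 _ _ _ _ (a1 _ hz) (b1 _ hz).
  have := normc_ge0 (F z * G z); lra.
- rewrite !mxE; have h1 := a2 _ hz i; have h2 := b2 _ hz i.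
  have h3 : 3 * normc (D z ord0 i) <= M1 by lra.
  have h4 : 3 * normc (E z ord0 i) <= M2 by lra.
  have := mul3 _ _ _ _ (a1 _ hz) h4; have := mul3 _ _ _ _ h3 (b1 _ hz).
  have := normcD (F z * E z ord0 i) (G z * D z ord0 i).
  rewrite [D _ _ _ * G z]mulrC.
  have := normc_ge0 (F z * E z ord0 i + G z * D z ord0 i).
  rewrite -/(GRing.scale _ _) /=; lra.
- have -> : F w * G w - F z * G z = F w * (G w - G z) + (F w - F z) * G z by ring.
  have := mul3 _ _ _ _ (a1 _ hw) (b3 _ _ _ hz hw d0 hd).
  have := mul3 _ _ _ _ (a3 _ _ _ hz hw d0 hd) (b1 _ hz).
  have := normcD (F w * (G w - G z)) ((F w - F z) * G z).
  have := normc_ge0 (F w * (G w - G z) + (F w - F z) * G z); nra.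
- rewrite pairingDl !pairingZl; set q := pairing (E z) _.
  set p := pairing (D z) _.
  have -> : F w * G w - F z * G z - (F z * q + G z * p) =
    F z * (G w - G z - q) + ((F w - F z - p) * G z
      + (F w - F z) * (G w - G z)) by ring.
  have h1 := mul3 _ _ _ _ (a1 _ hz) (b4 _ _ _ hz hw d0 hd).
  have h2 := mul3 _ _ _ _ (a4 _ _ _ hz hw d0 hd) (b1 _ hz).
  have h3 := mul3 _ _ _ _ (a3 _ _ _ hz hw d0 hd) (b3 _ _ _ hz hw d0 hd).
  have -> : M1 * M2 * d ^+ 2 = (M1 * (M2 * d ^+ 2) + (M1 * d ^+ 2 * M2)
    + (M1 * d * (M2 * d))) / 3 by field.
  move: h1 h2 h3; set u := F z * _; set v := _ * G z; set t := (F w - _) * _.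
  have := normcD u (v + t); have := normcD v t; lra.
Qed.

Lemma jet_size_exp r M F m : jet_size r M F ->
  jet_size r (M ^+ m.+1) (fun z => F z ^+ m.+1).
Proof.
move=> h; elim: m => [//|m IH]; rewrite exprS.
by under [X in jet_size _ _ X]funext do rewrite exprS; exact: jet_sizeM.
Qed.

Lemma jet_sizeZ r M F (c : R[i]) : 0 <= r -> jet_size r M F ->
  jet_size r (normc c * M) (fun z => c * F z).
Proof.
move=> r0 [D [h1 h2 h3 h4]]; have c0 := normc_ge0 c.
exists (fun z => c *: D z); split => [z hz|z hz i|z w d hz hw d0 hd|
  z w d hz hw d0 hd].
- by rewrite normcM; have := h1 _ hz; nra.
- by rewrite mxE normcM; have := h2 _ hz i; nra.
- by rewrite -mulrBr normcM; have := h3 _ _ _ hz hw d0 hd; nra.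
- rewrite pairingZl -!mulrBr normcM.
  by have := h4 _ _ _ hz hw d0 hd; nra.
Qed.

(** The bound of the constant 1 is 3, so expanding [(1 - F)^K] naively would be
    useless. The recursion [e_(K+1) = e_K + F - F e_K] for [e_K = 1 - (1 - F)^K]
    only multiplies quantities that vanish with [F]. *)
Lemma jet_size_onem r M F K : 0 <= r -> jet_size r M F ->
  jet_size r ((1 + M) ^+ K.+1 - 1) (fun z => 1 - (1 - F z) ^+ K.+1).
Proof.
move=> r0 h; have M0 := jet_size_ge0 r0 h.
elim: K => [|K IH].
  rewrite expr1; have -> : 1 + M - 1 = M by ring.
  by under [X in jet_size _ _ X]funext do rewrite expr1 opprB addrC subrK.
have -> : (fun z => 1 - (1 - F z) ^+ K.+2) =
    (fun z => F z + (1 - (1 - F z) ^+ K.+1) + (-1) * (F z * (1 - (1 - F z) ^+ K.+1))).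
  by apply: funext => z; rewrite [in LHS]exprS; ring.
have -> : (1 + M) ^+ K.+2 - 1 =
    M + ((1 + M) ^+ K.+1 - 1) + normc (-1 : R[i]) * (M * ((1 + M) ^+ K.+1 - 1)).
  by rewrite normcN normc1 exprS; ring.
apply: jet_sizeD; first exact: jet_sizeD.
by apply: jet_sizeZ => //; exact: jet_sizeM.
Qed.

End Jets.

(** * Complex differentiability from second-order Taylor bounds *)

Lemma differentiable_remainder (K : numFieldType) (V W : normedModType K)
    (f : V -> W) (L : {linear V -> W}) (x : V) :
  continuous L ->
  (forall e : K, 0 < e -> \forall h \near 0, `|f (h + x) - f x - L h| <= e * `|h|) ->
  differentiable f x.
Proof.
move=> Lc h; suff dF : f \o shift x = cst (f x) + L +o_ 0 id.
  by apply/diff_locallyP; rewrite (diff_unique Lc dF).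
apply/eqaddoP => e /h; apply: filterS => k.
by rewrite -addrA -opprD.
Qed.

Section ComplexTopology.
Variables (R : realType) (N : nat).
Local Notation Y := 'rV[R[i]^o]_N.
Implicit Types (z w : Y).

Lemma normrC_real (V : normedModType R[i]) (v : V) : `|v| = (complex.Re `|v|)%:C.
Proof. by rewrite RRe_real // normr_real. Qed.

Lemma coord_le_norm z i : normc (z ord0 i) <= complex.Re `|z|.
Proof.
apply/ler_addgt0Pr => e e0.
have : ball (0 : Y) (complex.Re `|z| + e)%:C z.
  rewrite mx_norm_ball /ball_ /= sub0r normrN normrC_real ltcR; lra.
case=> _ /(_ ord0 i); rewrite /ball /= /ball_ /= normr_normc ltcR mxE.
by rewrite normcC subr0 => /ltW.
Qed.

(** The balls of a normed space over [C] have radii in [R[i]]; this lemma and the next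
    pass to real radii. *)
Lemma near_polydisc z (e : R) : 0 < e -> \forall w \near z, polydisc e (w - z).
Proof.
move=> e0; apply/nbhs_ballP; exists e%:C => /=; first by rewrite -[0]/(0%:C) ltcR.
move=> w [_ h] i; have := h ord0 i.
by rewrite /ball /= /ball_ /= normr_normc ltcR !mxE normcC => /ltW.
Qed.

Lemma nbhs_polydisc z (P : Y -> Prop) : (\forall w \near z, P w) ->
  exists2 e : R, 0 < e & forall w, polydisc e (w - z) -> P w.
Proof.
move=> /nbhs_ballP [e0 /= e00 h]; exists (complex.Re e0 / 2).
  by move: e00; rewrite ltcE /= => /andP[_ ?]; rewrite divr_gt0.
move: e00; rewrite ltcE /= => /andP[/eqP Ie0 Re0] w hw; apply: h.
have -> : e0 = (complex.Re e0)%:C by case: e0 Ie0 {Re0 hw} => a b /= ->.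
split; first by rewrite ltcR.
move=> i j; rewrite (ord1 i) /ball /= /ball_ /= normr_normc ltcR.
by have := hw j; rewrite !mxE normcC; lra.
Qed.

Lemma near_normc (x : R[i]^o) (e : R) : 0 < e ->
  \forall y \near x, normc (y - x) < e.
Proof.
move=> e0; apply/nbhs_ballP; exists e%:C => /=; first by rewrite -[0]/(0%:C) ltcR.
by move=> w; rewrite /ball /= normr_normc ltcR normcC.
Qed.

Lemma cvg_normcP (T : Type) (F : set_system T) {FF : Filter F}
    (f : T -> R[i]^o) (l : R[i]^o) :
  f @ F --> l <-> forall e : R, 0 < e -> \forall t \near F, normc (f t - l) < e.
Proof.
split=> [h e e0|h]; first exact: h (near_normc _ e0).
apply/cvgrPdist_lt => e; rewrite ltcE /= => /andP[/eqP Ie Re].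
apply: filterS (h _ Re) => t; rewrite normr_normc normcC.
by case: e Ie {Re} => a b /= ->; rewrite ltcR.
Qed.

Lemma jet_bounded_differentiable (r s M : R) (F : Y -> R[i]^o) (D : Y -> Y) z :
  jet_bounded r M F D -> polydisc s z -> s < r -> differentiable F z.
Proof.
move=> jF zs sr.
have zr : polydisc r z by apply: polydisc_le zs; exact: ltW.
have lin : linear (pairing (D z) : Y -> R[i]^o).
  by move=> c u v; rewrite pairingDr pairingZr.
pose lM := GRing.isLinear.Build _ _ _ _ _ lin.
pose L : {linear Y -> R[i]^o} := HB.pack (pairing (D z) : Y -> R[i]^o) lM.
have Lc : continuous L.
  move=> w; apply/(@cvg_normcP _ (nbhs w) (nbhs_filter w) L (L w)) => e e0.
  pose A := 1 + \sum_i normc (D z ord0 i).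
  have A1 : 1 <= A by rewrite lerDl sumr_ge0.
  have eA : 0 < e / A / 2 by rewrite !divr_gt0 //; lra.
  apply: filterS (near_polydisc w eA) => v hv.
  rewrite -linearB /= /pairing; apply: le_lt_trans (normc_sum _ _ _) _.
  apply: (@le_lt_trans _ _ (A * (e / A / 2))).
    rewrite /A mulrDl mul1r -[leLHS]add0r lerD ?(ltW eA) // mulr_suml.
    by apply: ler_sum => i _; rewrite normcM ler_wpM2l.
  have -> : A * (e / A / 2) = e / 2 by field; lra.
  lra.
suff dF e : 0 < e ->
    \forall h \near (0 : Y), `|F (h + z) - F z - L h : R[i]^o| <= e * `|h|.
  exact: differentiable_remainder Lc dF.
  rewrite ltcE /= => /andP[/eqP Ie Re].
  have -> : e = (complex.Re e)%:C by case: e Ie {Re} => a b /= ->.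
  move: (complex.Re e) Re => {Ie}e e0.
  have M1 : 0 < `|M| + 1 by have := normr_ge0 M; lra.
  have e1 : 0 < Num.min (r - s) (e / (`|M| + 1)).
    by rewrite lt_min subr_gt0 sr divr_gt0.
  have nh : \forall h \near (0 : Y), complex.Re `|h| < Num.min (r - s) (e / (`|M| + 1)).
    have e1C : 0 < (Num.min (r - s) (e / (`|M| + 1)))%:C by rewrite -[0]/(0%:C) ltcR.
    apply/nbhs_normP; exists (Num.min (r - s) (e / (`|M| + 1)))%:C => //= h.
    by rewrite /ball_ /= sub0r normrN normrC_real ltcR.
  apply: filterS nh => h; rewrite lt_min => /andP[h1 h2].
  set d := complex.Re `|h|; have hd : polydisc d h by move=> i; exact: coord_le_norm.
  have d0 : 0 <= d.
    by rewrite -lecR -normrC_real; exact: normr_ge0.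
  have zh : polydisc r (h + z).
    move=> i; rewrite mxE; apply: le_trans (normcD _ _) _.
    have := hd i; have := zs i; rewrite /d; lra.
  have hd' : polydisc d (h + z - z) by rewrite addrK.
  have := jet_remainder jF zr zh d0 hd'.
  rewrite addrK => hrem.
  rewrite normr_normc normrC_real -/d -rmorphM lecR.
  have : d * (`|M| + 1) < e by rewrite -ltr_pdivlMr.
  have := ler_norm M; move: hrem; set q := normc _ => hrem MM hdM.
  have : d * d * M <= d * d * `|M| by rewrite ler_wpM2l ?mulr_ge0.
  rewrite expr2 in hrem.
  have : 0 <= d * d by rewrite mulr_ge0.
  nra.
Qed.

End ComplexTopology.

(** * Series of functions with geometrically decaying jets *)

Lemma cvg_lincomb (K : numFieldType) (I : Type) (s : seq I)
    (a_ : nat -> I -> K^o) (a b : I -> K^o) :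
  (forall i, a_ ^~ i @ \oo --> a i) ->
  (fun J => \sum_(i <- s) a_ J i * b i) @ \oo --> \sum_(i <- s) a i * b i.
Proof.
move=> h; elim: s => [|i s IH].
  by rewrite big_nil; under eq_fun do rewrite big_nil; exact: cvg_cst.
rewrite big_cons; under eq_fun do rewrite big_cons.
by apply: cvgD => //; apply: cvgM => //; exact: cvg_cst.
Qed.

Section Series.
Variables (R : realType).

Lemma le_normc_cvg (c : nat -> R[i]^o) (l : R[i]^o) (b : R) :
  c @ \oo --> l -> (forall J, normc (c J) <= b) -> normc l <= b.
Proof.
move=> /cvg_normcP cl cb; apply/ler_addgt0Pr => e e0.
have [J _ /(_ J (leqnn J)) /= h] := cl _ e0.
have -> : l = c J - (c J - l) by ring.
apply: le_trans (normcB _ _) _; apply: lerD => //; exact: ltW.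
Qed.

Lemma sum_half_powers (A : R) J : \sum_(j < J) A * 2^-1 ^+ j = 2 * A - 2 * A * 2^-1 ^+ J.
Proof.
elim: J => [|J IH]; first by rewrite big_ord0 expr0; ring.
by rewrite big_ord_recr /= IH exprS; field.
Qed.

Lemma half_power_gt0 m : 0 < 2^-1 ^+ m :> R.
Proof. by rewrite exprn_gt0 // invr_gt0. Qed.

(** Completeness of [C] enters only here, through the real and imaginary parts. *)
Lemma geometric_dominated_cvg (c : nat -> R[i]) (A : R) :
  (forall j, normc (c j) <= A * 2^-1 ^+ j) ->
  exists l : R[i]^o, (fun J => \sum_(j < J) c j : R[i]^o) @ \oo --> l.
Proof.
move=> cA.
have real_cvg (a : nat -> R) : (forall j, `|a j| <= A * 2^-1 ^+ j) ->
    (fun J => \sum_(j < J) a j) @ \oo --> limn (series a).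
  move=> aA; have : cvgn (series a).
    apply: normed_cvg; apply: (@series_le_cvg _ _ (geometric A 2^-1)) => //=.
    - by move=> j; apply: le_trans (aA j).
    - by apply: is_cvg_geometric_series; rewrite ger0_norm ?invr_ge0 // invf_lt1 // ltr1n.
  by rewrite /series /=; under eq_fun do rewrite big_mkord.
have h1 := real_cvg (fun j => complex.Re (c j))
  (fun j => le_trans (Re_le_normc _) (cA j)).
have h2 := real_cvg (fun j => complex.Im (c j))
  (fun j => le_trans (Im_le_normc _) (cA j)).
move: h1 h2; set a := limn _; set b := limn _ => h1 h2.
exists (a +i* b); apply/cvg_normcP => e e0.
have e20 : 0 < e / 2 by rewrite divr_gt0.
move/cvgrPdist_lt/(_ _ e20): h1; move/cvgrPdist_lt/(_ _ e20): h2.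
apply: filterS2 => J k2 k1; apply: le_lt_trans (normc_Re_Im _) _.
have -> : \sum_(j < J) c j =
    (\sum_(j < J) complex.Re (c j)) +i* (\sum_(j < J) complex.Im (c j)).
  elim: J {k1 k2} => [|J IH]; first by rewrite !big_ord0.
  by rewrite !big_ord_recr /= IH; case: (c J) => x y.
rewrite /= -/(complex.Re _) distrC [X in _ + X]distrC; lra.
Qed.

Variable N : nat.
Local Notation Y := 'rV[R[i]^o]_N.

Lemma pairing_cvg (D_ : nat -> Y) (D w : Y) :
  (forall i, (fun J => D_ J ord0 i) @ \oo --> D ord0 i) ->
  (fun J => pairing (D_ J) w : R[i]^o) @ \oo --> (pairing D w : R[i]^o).
Proof.
move=> h; exact: (@cvg_lincomb _ _ _ (fun J i => D_ J ord0 i) (fun i => D ord0 i)).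
Qed.

(** Every bound is a closed condition on finitely many values of the function and
    its gradient, so pointwise convergence of both is enough. *)
Lemma jet_bounded_lim r M (F_ : nat -> Y -> R[i]^o) (D_ : nat -> Y -> Y)
    (F : Y -> R[i]^o) (D : Y -> Y) :
  (forall J, jet_bounded r M (F_ J) (D_ J)) ->
  (forall z, polydisc r z -> F_ ^~ z @ \oo --> F z) ->
  (forall z i, polydisc r z -> (fun J => D_ J z ord0 i) @ \oo --> D z ord0 i) ->
  jet_bounded r M F D.
Proof.
move=> jF cF cD.
have le3 (c : nat -> R[i]^o) (l : R[i]^o) (b : R) : c @ \oo --> l ->
    (forall J, 3 * normc (c J) <= b) -> 3 * normc l <= b.
  move=> cl cb; have : normc l <= b / 3.
    by apply: le_normc_cvg cl _ => J; have := cb J; lra.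
  lra.
split=> [z hz|z hz i|z w d hz hw d0 hd|z w d hz hw d0 hd].
- by apply: (le3 _ _ _ (cF _ hz)) => J; exact: (jet_value (jF J)).
- by apply: (le_normc_cvg (cD z i hz)) => J; exact: (jet_gradient (jF J)).
- apply: (le3 (fun J => F_ J w - F_ J z)).
    by apply: cvgB; exact: cF.
  by move=> J; exact: (jet_lipschitz (jF J)).
- apply: (le3 (fun J => F_ J w - F_ J z - pairing (D_ J z) (w - z))).
    apply: cvgB; first by apply: cvgB; exact: cF.
    by apply: pairing_cvg => i; exact: cD.
  by move=> J; exact: (jet_remainder (jF J)).
Qed.

(** The part of the class of entire functions in which the approximations are built:
    it contains the polynomials and is closed under the ring operations. *)
Definition jet_tame (F : Y -> R[i]) := forall r, exists M, jet_size r M F.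

Lemma jet_bounded_sum r (a : nat -> R) (F_ : nat -> Y -> R[i]) (D_ : nat -> Y -> Y) J :
  (forall j, jet_bounded r (a j) (F_ j) (D_ j)) ->
  jet_bounded r (\sum_(j < J) a j) (fun z => \sum_(j < J) F_ j z)
    (fun z => \sum_(j < J) D_ j z).
Proof.
move=> jF; elim: J => [|J IH].
  split=> [z _|z _ i|z w d _ _ _ _|z w d _ _ _ _]; rewrite ?big_ord0 ?mul0r //.
  - by rewrite normc0 mulr0.
  - by rewrite mxE normc0.
  - by rewrite subrr normc0 mulr0.
  - by rewrite pairing0 !subr0 normc0 mulr0.
rewrite big_ord_recr /=.
have -> : (fun z => \sum_(j < J.+1) F_ j z) =
    (fun z => \sum_(j < J) F_ j z + F_ J z).
  by apply: funext => z; rewrite big_ord_recr.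
have -> : (fun z => \sum_(j < J.+1) D_ j z) =
    (fun z => \sum_(j < J) D_ j z + D_ J z).
  by apply: funext => z; rewrite big_ord_recr.
exact: jet_boundedD.
Qed.

Lemma tame_geometric_bound (F_ : nat -> Y -> R[i]) r :
  0 <= r ->
  (forall j, jet_tame (F_ j)) ->
  (\forall j \near \oo, jet_size r (2^-1 ^+ j) (F_ j)) ->
  exists2 A, 0 <= A & forall j, jet_size r (A * 2^-1 ^+ j) (F_ j).
Proof.
move=> r0 tF [j0 _ jF].
have /choice [M hM] : forall j, exists M, jet_size r M (F_ j) by move=> j; exact: tF.
have M0 j : 0 <= M j by exact: jet_size_ge0 (hM j).
(* The finitely many terms before [j0] are absorbed in the constant. *)
exists (1 + \sum_(j < j0) M j * 2 ^+ j).
  by rewrite addr_ge0 // sumr_ge0 // => j _; rewrite mulr_ge0 // exprn_ge0.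
move=> j; have [jj0|jj0] := leqP j0 j.
  apply: jet_size_le (jF _ jj0); rewrite ler_peMl //.
  by rewrite lerDl sumr_ge0 // => k _; rewrite mulr_ge0 // exprn_ge0.
apply: jet_size_le (hM j).
have h : M j * 2 ^+ j <= 1 + \sum_(j < j0) M j * 2 ^+ j.
  rewrite (bigD1 (Ordinal jj0)) //= addrCA lerDl addr_ge0 // sumr_ge0 //.
  by move=> k _; rewrite mulr_ge0 // exprn_ge0.
have := ler_wpM2r (ltW (half_power_gt0 j)) h; apply: le_trans.
by rewrite -mulrA -exprMn divff // expr1n mulr1.
Qed.

(** The weak form of Weierstrass' theorem that the construction needs: the gradients
    are summed along with the values, so no Cauchy estimate is involved. *)
Lemma entire_series (F_ : nat -> Y -> R[i]) :
  (forall j, jet_tame (F_ j)) ->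
  (forall r, \forall j \near \oo, jet_size r (2^-1 ^+ j) (F_ j)) ->
  exists2 F : Y -> R[i]^o, entire F &
    forall z, (fun J => \sum_(j < J) F_ j z : R[i]^o) @ \oo --> F z.
Proof.
move=> tF jF.
pose rad (z : Y) : R := \sum_i normc (z ord0 i).
have rad0 z : 0 <= rad z by apply: sumr_ge0 => i _; exact: normc_ge0.
have hrad (z : Y) : polydisc (rad z) z.
  by move=> i; rewrite /rad (bigD1 i) //= lerDl; apply: sumr_ge0 => j _; exact: normc_ge0.
have cvgF z : exists l : R[i]^o, (fun J => \sum_(j < J) F_ j z : R[i]^o) @ \oo --> l.
  have [A A0 hA] := tame_geometric_bound (rad0 z) tF (jF (rad z)).
  apply: (@geometric_dominated_cvg (fun j => F_ j z) A) => j.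
  have [D [/(_ _ (hrad z)) h _ _ _]] := hA j.
  by have := normc_ge0 (F_ j z); lra.
have [F hF] := choice cvgF.
exists F; last exact: hF.
move=> z.
have r0 : 0 <= rad z + 1 by rewrite addr_ge0.
have [A A0 /choice[D_ hD]] := tame_geometric_bound r0 tF (jF (rad z + 1)).
have cvgD w i : polydisc (rad z + 1) w -> exists l : R[i]^o,
    (fun J => \sum_(j < J) D_ j w ord0 i : R[i]^o) @ \oo --> l.
  move=> hw; apply: (@geometric_dominated_cvg (fun j => D_ j w ord0 i) (A / 3)) => j.
  by apply: le_trans (jet_gradient (hD j) hw i) _; lra.
pose D w : Y := \row_i lim ((fun J => \sum_(j < J) D_ j w ord0 i : R[i]^o) @ \oo).
apply: (@jet_bounded_differentiable _ _ (rad z + 1) (rad z) (2 * A) F D) => //;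
  last by rewrite ltrDl.
apply: (@jet_bounded_lim _ _ (fun J w => \sum_(j < J) F_ j w)
  (fun J w => \sum_(j < J) D_ j w)) => [J|w _|w i hw]; last 2 first.
- exact: hF.
- have [l hl] := cvgD w i hw.
  have -> : (fun J => (\sum_(j < J) D_ j w) ord0 i) =
      (fun J => \sum_(j < J) D_ j w ord0 i) by apply: funext => J; rewrite summxE.
  rewrite mxE (cvg_lim _ hl); first exact: hl.
  exact: norm_hausdorff.
apply: jet_bounded_le (jet_bounded_sum J hD); rewrite sum_half_powers.
by rewrite gerBl mulr_ge0 ?mulr_ge0 // ltW // half_power_gt0.
Qed.

End Series.

(** * The step polynomials *)

(** On [[0, 1]] and for large [m] this is close to 0 below [1 / k] and close to 1
    above, the threshold being where [k t] crosses 1. *)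
Definition step (A : pzRingType) (k m : nat) (t : A) : A :=
  1 - (1 - t ^+ m.+1) ^+ (k ^ m.+1).

Section RealStep.
Variables (R : realType) (k m : nat).
Implicit Types t : R.

Lemma step_base t : 0 <= t <= 1 -> 0 <= 1 - t ^+ m.+1 <= 1.
Proof.
move=> /andP[t0 t1]; have h0 : 0 <= t ^+ m.+1 by rewrite exprn_ge0.
have h1 : t ^+ m.+1 <= 1 by rewrite exprn_ile1.
by apply/andP; split; lra.
Qed.

Lemma step_itv t : 0 <= t <= 1 -> 0 <= step k m t <= 1.
Proof.
move=> /step_base /andP[h0 h1]; rewrite /step.
have := exprn_ge0 (k ^ m.+1) h0; have := exprn_ile1 (k ^ m.+1) h0 h1.
by move=> *; apply/andP; split; lra.
Qed.

Lemma bernoulli (x : R) K : 0 <= x <= 1 -> 1 - K%:R * x <= (1 - x) ^+ K.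
Proof.
move=> /andP[x0 x1]; elim: K => [|K IH]; first by rewrite mul0r subr0 expr0.
rewrite exprS -natr1.
have : (1 - x) * (1 - K%:R * x) <= (1 - x) * (1 - x) ^+ K.
  by rewrite ler_wpM2l //; lra.
have : 0 <= K%:R * (x * x) by rewrite mulr_ge0 // mulr_ge0.
by set u := (1 - x) ^+ K; nra.
Qed.

Lemma bernoulliD (x : R) K : 0 <= x -> 1 + K%:R * x <= (1 + x) ^+ K.
Proof.
move=> x0; elim: K => [|K IH]; first by rewrite mul0r addr0 expr0.
rewrite exprS -natr1.
have : (1 + x) * (1 + K%:R * x) <= (1 + x) * (1 + x) ^+ K.
  by rewrite ler_wpM2l //; lra.
have : 0 <= K%:R * (x * x) by rewrite mulr_ge0 // mulr_ge0.
by set u := (1 + x) ^+ K; nra.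
Qed.

Lemma step_small t : 0 <= t <= 1 -> k%:R * t <= 2^-1 -> step k m t <= 2^-1 ^+ m.+1.
Proof.
move=> /andP[t0 t1] kt.
have h : 0 <= t ^+ m.+1 <= 1 by rewrite exprn_ge0 // exprn_ile1.
have := bernoulli (k ^ m.+1) h; rewrite natrX -exprMn /step.
have : (k%:R * t) ^+ m.+1 <= 2^-1 ^+ m.+1 by apply: lerXn2r => //; rewrite nnegrE ?invr_ge0 // mulr_ge0.
lra.
Qed.

(** Because [(1 - x)^K (1 + K x) <= (1 - x^2)^K <= 1] with [x = t^m], [K = k^m]. *)
Lemma step_large t : 0 <= t <= 1 -> 2 <= k%:R * t ->
  1 - 2^-1 ^+ m.+1 <= step k m t.
Proof.
move=> /andP[t0 t1] kt; rewrite /step lerD2l lerN2.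
set x := t ^+ m.+1; set K := (k ^ m.+1)%N.
have x0 : 0 <= x by rewrite exprn_ge0.
have x1 : x <= 1 by rewrite exprn_ile1.
have y0 : 0 <= (1 - x) ^+ K by rewrite exprn_ge0 // subr_ge0.
have Kx : 2 ^+ m.+1 <= K%:R * x.
  by rewrite natrX -exprMn; apply: lerXn2r => //; rewrite nnegrE ?mulr_ge0.
have le1 : (1 - x) ^+ K * (1 + x) ^+ K <= 1.
  rewrite -exprMn; apply: exprn_ile1; first by apply: mulr_ge0; lra.
  by have := sqr_ge0 x; nra.
have le2 : (1 - x) ^+ K * 2 ^+ m.+1 <= 1.
  apply: le_trans le1; rewrite ler_wpM2l //.
  by apply: le_trans (bernoulliD K x0); lra.
by rewrite exprVn -[leRHS]mul1r ler_pdivlMr // exprn_gt0.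
Qed.

End RealStep.

Lemma step_complex (R : realType) k m (t : R) : step k m t%:C = (step k m t)%:C :> R[i].
Proof. by rewrite /step rmorphB rmorph1 rmorphXn rmorphB rmorph1 rmorphXn. Qed.

Section Tame.
Variables (R : realType) (N : nat).
Local Notation Y := 'rV[R[i]^o]_N.
Implicit Types (F G : Y -> R[i]).

Lemma expr1D_le (x : R) j K : 0 <= x -> (j <= K)%N -> K%:R * x <= 2^-1 ->
  (1 + x) ^+ j <= 1 + 2 * j%:R * x.
Proof.
move=> x0 + Kx; elim: j => [|j IH] jK; first by rewrite mulr0 mul0r addr0 expr0.
have jx : j%:R * x <= 2^-1.
  by apply: le_trans Kx; rewrite ler_wpM2r // ler_nat ltnW.
have := ler_wpM2l (addr_ge0 ler01 x0) (IH (ltnW jK)).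
rewrite exprS -natr1; have : 0 <= j%:R * x by rewrite mulr_ge0.
by set u := (1 + x) ^+ j; nra.
Qed.

(** On a polydisc where [k F] has size at most 1/2, the cutoff is small together with
    its derivative: [(1 + x)^K - 1 <= 2 K x] with [K x = 2^-m]. No sign or
    reality of [F] is required, which is what gives smallness on a part of [C^N]. *)
Lemma jet_size_step r F k m : 0 <= r -> (0 < k)%N ->
  jet_size r (2 * k%:R)^-1 F -> jet_size r (2^-1 ^+ m) (fun z => step k m (F z)).
Proof.
move=> r0 k0 /(jet_size_exp m) h; rewrite /step.
have K0 : (0 < k ^ m.+1)%N by rewrite expn_gt0 k0.
have := jet_size_onem (k ^ m.+1).-1 r0 h; rewrite prednK //; apply: jet_size_le.
set x := _ ^+ m.+1.
have x0 : 0 <= x by rewrite exprn_ge0 // invr_ge0 mulr_ge0.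
have Kx : (k ^ m.+1)%:R * x = 2^-1 ^+ m.+1.
  rewrite natrX -exprMn; congr (_ ^+ _); rewrite invfM mulrCA divff ?mulr1 //.
  by rewrite pnatr_eq0 -lt0n.
have := @expr1D_le x _ _ x0 (leqnn (k ^ m.+1)).
rewrite -mulrA Kx exprS; have := half_power_gt0 R m => p0 h'.
have : 2^-1 * 2^-1 ^+ m <= (2^-1 : R).
  by rewrite ler_piMr // exprn_ile1 // invf_le1 // ler1n.
move/h'; lra.
Qed.

Lemma jet_tame_const (c : R[i]) : jet_tame (fun _ : Y => c).
Proof. by move=> r; exists (3 * normc c); exact: jet_size_const. Qed.

Lemma jet_tame_coord (i : 'I_N) : jet_tame (fun z : Y => z ord0 i).
Proof.
move=> r; exists (3 * Num.max r 1).
apply: (@jet_size_radius _ _ r (Num.max r 1)); first by rewrite le_max lexx.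
by apply: jet_size_coord; rewrite le_max lexx orbT.
Qed.

Lemma jet_tameD F G : jet_tame F -> jet_tame G -> jet_tame (fun z => F z + G z).
Proof.
by move=> hF hG r; have [A ?] := hF r; have [B ?] := hG r; exists (A + B);
  exact: jet_sizeD.
Qed.

Lemma jet_tameM F G : jet_tame F -> jet_tame G -> jet_tame (fun z => F z * G z).
Proof.
by move=> hF hG r; have [A ?] := hF r; have [B ?] := hG r; exists (A * B);
  exact: jet_sizeM.
Qed.

Lemma jet_tameB F G : jet_tame F -> jet_tame G -> jet_tame (fun z => F z - G z).
Proof.
move=> hF hG; have := jet_tameD hF (jet_tameM (jet_tame_const (-1)) hG).
by under [X in jet_tame X]funext do rewrite mulN1r.
Qed.

Lemma jet_tameX F m : jet_tame F -> jet_tame (fun z => F z ^+ m).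
Proof.
move=> hF; elim: m => [|m IH]; first exact: jet_tame_const.
by under [X in jet_tame X]funext do rewrite exprS; exact: jet_tameM.
Qed.

Lemma jet_tame_sum (I : Type) (s : seq I) (F_ : I -> Y -> R[i]) :
  (forall i, jet_tame (F_ i)) -> jet_tame (fun z => \sum_(i <- s) F_ i z).
Proof.
move=> h; elim: s => [|i s IH].
  by under [X in jet_tame X]funext do rewrite big_nil; exact: jet_tame_const.
by under [X in jet_tame X]funext do rewrite big_cons; exact: jet_tameD.
Qed.

Lemma jet_tame_step F k m : jet_tame F -> jet_tame (fun z => step k m (F z)).
Proof.
by move=> hF; do 2 (apply: jet_tameB; first exact: jet_tame_const;
  apply: jet_tameX).
Qed.

Definition embed (x : 'rV[R]_N) : Y := map_mx (real_complex R) x.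

Definition sqdist (x y : 'rV[R]_N) : R := \sum_i (x ord0 i - y ord0 i) ^+ 2.

(** The holomorphic extension of [x |-> sqdist x c]; no conjugation is involved. *)
Definition csqdist (c : 'rV[R]_N) (z : Y) : R[i] :=
  \sum_i (z ord0 i - (c ord0 i)%:C) ^+ 2.

Lemma csqdist_embed c x : csqdist c (embed x) = (sqdist x c)%:C.
Proof.
rewrite /csqdist /sqdist rmorph_sum; apply: eq_bigr => i _.
by rewrite mxE rmorphXn rmorphB.
Qed.

Lemma sqdist_ge0 x y : 0 <= sqdist x y.
Proof. by apply: sumr_ge0 => i _; exact: sqr_ge0. Qed.

Lemma jet_tame_csqdist c : jet_tame (csqdist c).
Proof.
apply: jet_tame_sum => i; apply: jet_tameX; apply: jet_tameB.
  exact: jet_tame_coord.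
exact: jet_tame_const.
Qed.

Lemma jet_size_csqdist0 r : 1 <= r -> jet_size r (9 * N%:R * r ^+ 2) (csqdist 0).
Proof.
move=> r1.
have h (s : seq 'I_N) : jet_size r ((size s)%:R * (9 * r ^+ 2))
    (fun z : Y => \sum_(i <- s) z ord0 i ^+ 2).
  elim: s => [|i s IH].
    under [X in jet_size _ _ X]funext do rewrite big_nil.
    by apply: jet_size_le (jet_size_const _ _ _); rewrite normc0 mulr0 mul0r.
  under [X in jet_size _ _ X]funext do rewrite big_cons.
  have -> : (size (i :: s))%:R * (9 * r ^+ 2) =
      (3 * r) ^+ 2 + (size s)%:R * (9 * r ^+ 2).
    by rewrite /= -natr1; ring.
  by apply: jet_sizeD => //; apply: (jet_size_exp 1); exact: jet_size_coord.
have := h (index_enum _).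
have -> : size (index_enum 'I_N) = N by rewrite -[RHS]card_ord cardT enumT.
have -> : N%:R * (9 * r ^+ 2) = 9 * N%:R * r ^+ 2 by ring.
congr (jet_size _ _ _); apply: funext => z; apply: eq_bigr => i _.
by rewrite mxE subr0.
Qed.

End Tame.

(** * Density of polynomials on compact subsets of real space *)

Section Patching.
Variables (R : realType) (I : eqType).

(** Starting from 0, the values [c i] are blended in with weights [h i], the head
    last. The weights [h i] need not add up to 1: each stage is a convex
    combination. *)
Fixpoint patch (A : pzRingType) (h c : I -> A) (s : seq I) : A :=
  if s is i :: s' then h i * c i + (1 - h i) * patch h c s' else 0.

Lemma normc_convex (h : R) (x y : R[i]) : 0 <= h <= 1 ->
  normc (h%:C * x + (1 - h%:C) * y) <= h * normc x + (1 - h) * normc y.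
Proof.
move=> /andP[h0 h1]; apply: le_trans (normcD _ _) _.
rewrite !normcM -[1]/(1%:C) -rmorphB !normcR !ger0_norm //; lra.
Qed.

Variables (h : I -> R) (c : I -> R[i]) (a : R[i]) (b M eta : R).

Lemma patch_bounded s : 0 <= M -> {in s, forall i, 0 <= h i <= 1} ->
  {in s, forall i, normc (c i) <= M} ->
  normc (patch (fun i => (h i)%:C) c s) <= M.
Proof.
move=> M0; elim: s => [|i s IH] h01 cM; first by rewrite [patch _ _ _]/(0 : R[i]) normc0.
rewrite [patch _ _ _]/=.
have hi := h01 i (mem_head _ _); apply: le_trans (normc_convex _ _ hi) _.
have := cM i (mem_head _ _).
have /IH : {in s, forall i, 0 <= h i <= 1}.
  by move=> j js; apply: h01; rewrite inE js orbT.
have hs : {in s, forall i, normc (c i) <= M}.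
  by move=> j js; apply: cM; rewrite inE js orbT.
move=> /(_ hs); case/andP: hi; set u := normc _; set v := normc _; nra.
Qed.

(** At a point where the target value is [a], blending in a good value keeps the
    distance to [a], and blending in a bad one has weight at most [eta]. Once a
    good value has come in with weight at least [1 - eta], the result is good, up to
    [2 M eta] at each stage. *)
Lemma patch_close s : 0 <= eta -> normc a <= M ->
  {in s, forall i, 0 <= h i <= 1} -> {in s, forall i, normc (c i) <= M} ->
  {in s, forall i, normc (c i - a) <= b \/ h i <= eta} ->
  (exists2 i, i \in s & normc (c i - a) <= b /\ 1 - eta <= h i) ->
  normc (patch (fun i => (h i)%:C) c s - a) <= b + (size s)%:R * (2 * M * eta).
Proof.
move=> eta0 aM; have M0 : 0 <= M by apply: le_trans aM.
have Me : 0 <= 2 * M * eta by rewrite !mulr_ge0.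
elim: s => [|i s IH] h01 cM cb [j js jc] //=.
have h01s : {in s, forall i, 0 <= h i <= 1}.
  by move=> l ls; apply: h01; rewrite inE ls orbT.
have cMs : {in s, forall i, normc (c i) <= M}.
  by move=> l ls; apply: cM; rewrite inE ls orbT.
have cbs : {in s, forall i, normc (c i - a) <= b \/ h i <= eta}.
  by move=> l ls; apply: cb; rewrite inE ls orbT.
have hi := h01 i (mem_head _ _); have ci := cM i (mem_head _ _).
have gM := patch_bounded M0 h01s cMs.
set g := patch _ _ s in IH gM *.
have -> : (h i)%:C * c i + (1 - (h i)%:C) * g - a =
  (h i)%:C * (c i - a) + (1 - (h i)%:C) * (g - a) by ring.
apply: le_trans (normc_convex _ _ hi) _.
have caM : normc (c i - a) <= 2 * M by apply: le_trans (normcB _ _) _; lra.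
have gaM : normc (g - a) <= 2 * M by apply: le_trans (normcB _ _) _; lra.
have ca0 := normc_ge0 (c i - a); have ga0 := normc_ge0 (g - a).
have n0 : 0 <= (size s)%:R * (2 * M * eta) by rewrite mulr_ge0.
rewrite -natr1.
move: hi IH => /andP[hi0 hi1] IH; have hi1' : 0 <= 1 - h i by lra.
have [/hasP[l ls /asboolP[lc le]]|ns] := boolP
  (has (fun l => `[< normc (c l - a) <= b /\ 1 - eta <= h l >]) s).
  have {}IH : normc (g - a) <= b + (size s)%:R * (2 * M * eta).
    by apply: IH => //; exists l.
  have h1 := ler_wpM2l hi1' IH; have h2 := mulr_ge0 hi0 n0.
  have [cib|hie] := cb i (mem_head _ _).
    have h3 := ler_wpM2l hi0 cib. lra.
  have h3 : h i * normc (c i - a) <= eta * (2 * M) by apply: ler_pM.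
  have b0 := le_trans (normc_ge0 _) lc.
  have := mulr_ge0 hi0 b0; lra.
have ij : i = j.
  move: js; rewrite inE => /orP[/eqP //|js]; case/negP: ns.
  by apply/hasP; exists j => //; apply/asboolP.
rewrite -ij in jc; case: jc => cib hie.
have h1 : (1 - h i) * normc (g - a) <= eta * (2 * M) by apply: ler_pM => //; lra.
have b0 := le_trans (normc_ge0 _) cib.
have := ler_wpM2l hi0 cib; have := mulr_ge0 hi1' b0; lra.
Qed.

End Patching.

Section RowVectors.
Variables (R : realType) (N : nat).
Implicit Types x y : 'rV[R]_N.

Lemma near_sqdist x (P : 'rV[R]_N -> Prop) :
  (\forall y \near x, P y) <->
  exists2 d : R, 0 < d & forall y, sqdist y x < d -> P y.
Proof.
split=> [/nbhs_ballP [e /= e0 h]|[d d0 h]].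
  exists (e ^+ 2); first by rewrite exprn_gt0.
  move=> y yx; apply: h; split => // i j; rewrite (ord1 i) /ball /=.
  rewrite -(@ltr_pXn2r _ 2) ?nnegrE ?(ltW e0) // real_normK ?num_real //.
  apply: le_lt_trans yx; rewrite -sqrrN opprB /sqdist (bigD1 j) //= lerDl.
  by apply: sumr_ge0 => l _; exact: sqr_ge0.
apply/nbhs_ballP; exists (Num.min 1 (d / N.+1%:R)) => /=.
  by rewrite lt_min ltr01 divr_gt0.
move=> y [_ yx]; apply: h.
have hi i : (y ord0 i - x ord0 i) ^+ 2 <= d / N.+1%:R.
  have := yx ord0 i; rewrite /ball /= lt_min distrC => /andP[h1 h2].
  rewrite -real_normK ?num_real // expr2.
  by apply: le_trans (ltW h2); rewrite ler_piMr // ltW.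
apply: (@le_lt_trans _ _ (N%:R * (d / N.+1%:R))).
  rewrite /sqdist -[X in X%:R * _]card_ord -sum1_card natr_sum mulr_suml.
  by apply: ler_sum => i _; rewrite mul1r.
by rewrite mulrA ltr_pdivrMr // mulrC ltr_pM2l // ltr_nat.
Qed.

Lemma sqdistC x y : sqdist x y = sqdist y x.
Proof. by apply: eq_bigr => i _; rewrite -sqrrN opprB. Qed.

Lemma sqdist_triangle z x y : sqdist x y <= 2 * sqdist x z + 2 * sqdist z y.
Proof.
rewrite /sqdist !mulr_sumr -big_split /=; apply: ler_sum => i _.
have := sqr_ge0 ((x ord0 i - z ord0 i) - (z ord0 i - y ord0 i)).
nra.
Qed.

Definition cont_on (S : set 'rV[R]_N) (f : 'rV[R]_N -> R[i]) :=
  forall x, S x -> forall e : R, 0 < e ->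
    \forall y \near x, S y -> normc (f y - f x) < e.

Lemma tame_patch (h c : 'rV[R]_N -> 'rV[R[i]^o]_N -> R[i]) s :
  (forall i, jet_tame (h i)) -> (forall i, jet_tame (c i)) ->
  jet_tame (fun z => patch (h ^~ z) (c ^~ z) s).
Proof.
move=> hh hc; elim: s => [|i s IH] /=; first exact: jet_tame_const.
apply: jet_tameD; apply: jet_tameM => //.
by apply: jet_tameB => //; exact: jet_tame_const.
Qed.

Lemma archimedean_half_power (A e : R) : 0 < e -> exists m, A * 2^-1 ^+ m <= e.
Proof.
move=> e0; have A0 : 0 < `|A| + 1 by rewrite ltr_wpDl.
have [m hm] : exists m : nat, (`|A| + 1) / e < m%:R.
  exists (Num.trunc ((`|A| + 1) / e)).+1; exact: truncnS_gt.
exists m; rewrite exprVn ler_pdivrMr ?exprn_gt0 //.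
have : (m%:R : R) <= 2 ^+ m by rewrite -natrX ler_nat ltnW // ltn_expl.
move: hm; rewrite ltr_pdivrMr // => hm h2.
have := ler_norm A; set u := 2 ^+ m in h2 *; nra.
Qed.

(** The case of the Stone-Weierstrass theorem that is needed. The set is covered by
    finitely many balls on which [f] varies little; the step polynomials in the
    squared distance to the centres are approximate indicators of the balls, and
    [patch] blends the values of [f] at the centres. *)
Lemma tame_dense (K : set 'rV[R]_N) (f : 'rV[R]_N -> R[i]) (a e : R) :
  compact K -> (forall x, K x -> sqdist x 0 <= a) -> cont_on K f -> 0 < e ->
  exists2 P, jet_tame P & forall x, K x -> normc (P (embed x) - f x) <= e.
Proof.
move=> Kc Ka fc e0.
(* [D] bounds the squared diameter, so that [sqdist x y / D] lies in [[0, 1]]. *)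
pose D := 1 + 4 * `|a|.
have D0 : 0 < D by rewrite /D; have := normr_ge0 a; lra.
have KD x y : K x -> K y -> 0 <= sqdist x y / D <= 1.
  move=> /Ka xa /Ka ya; rewrite divr_ge0 ?sqdist_ge0 ?(ltW D0) //=.
  rewrite ler_pdivrMr // mul1r; apply: le_trans (sqdist_triangle 0 x y) _.
  by rewrite (sqdistC 0 y) /D; have := ler_norm a; lra.
have e20 : 0 < e / 2 by rewrite divr_gt0.
have /choice [k hk] : forall x, exists k : nat, (0 < k)%N /\ (K x ->
    forall y, K y -> k%:R * (sqdist y x / D) < 2 -> normc (f y - f x) < e / 2).
  move=> x; have [Kx|nKx] := pselect (K x); last by exists 1%N.
  have /near_sqdist [d d0 hd] := fc x Kx _ e20.
  exists (Num.trunc (2 * D / d)).+1; split => // _ y Ky.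
  set k := _.+1 => kt; apply: hd => //.
  have : 2 * D / d < k%:R by exact: truncnS_gt.
  have k0 : 0 < k%:R :> R by [].
  rewrite ltr_pdivrMr // => h1.
  move: kt; rewrite mulrA ltr_pdivrMr // => h2.
  by rewrite -(ltr_pM2l k0); lra.
pose U x := [set y | (k x)%:R * (sqdist y x / D) <= 2^-1].
have k0 x : 0 < (k x)%:R :> R by rewrite ltr0n; case: (hk x).
have cov : cover_compact K by rewrite -compact_cover.
have [s sK Ks] : finite_subset_cover K (fun x => (U x)^°) K.
  apply: cov => [x _|x Kx]; first exact: open_interior.
  exists x => //; rewrite /interior; apply/near_sqdist.
  exists (D / (2 * (k x)%:R)); first by rewrite divr_gt0 ?mulr_gt0.
  move=> y yx; rewrite /U /= mulrA ler_pdivrMr //.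
  by move: yx; rewrite ltr_pdivlMr ?mulr_gt0 //; lra.
(* [M] also bounds [f] on [K], where [f] is within [e / 2] of its value at a centre. *)
pose M := \sum_(x <- s) normc (f x) + e.
have fM x : x \in (s : seq _) -> normc (f x) + e <= M.
  move=> xs; rewrite lerD2r (big_rem x) //= lerDl.
  by apply: sumr_ge0 => i _; exact: normc_ge0.
have M0 : 0 <= M by apply: addr_ge0; [apply: sumr_ge0 => i _|exact: ltW].
have [m hm] := archimedean_half_power ((size s)%:R * (2 * M)) e20.
pose t x z := csqdist x z * (D^-1)%:C.
exists (fun z => patch (fun x => 1 - step (k x) m (t x z)) f s).
  apply: (@tame_patch (fun x z => 1 - step (k x) m (t x z)) (fun x _ => f x)) => x.
    apply: jet_tameB; first exact: jet_tame_const.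
    apply: jet_tame_step; apply: jet_tameM; first exact: jet_tame_csqdist.
    exact: jet_tame_const.
  exact: jet_tame_const.
move=> x Kx.
have -> : (fun y => 1 - step (k y) m (t y (embed x))) =
    (fun y => (1 - step (k y) m (sqdist x y / D))%:C).
  apply: funext => y.
  rewrite /t csqdist_embed -rmorphM step_complex.
  by rewrite [RHS]rmorphB rmorph1.
have sK' y : y \in (s : seq _) -> K y by move=> ys; have := sK y ys; rewrite inE.
have [y ys /interior_subset yx] := Ks x Kx.
have cl y' : y' \in (s : seq _) -> (k y')%:R * (sqdist x y' / D) < 2 ->
    normc (f y' - f x) <= e / 2.
  move=> y's ky'; rewrite normcC ltW //; have [_ hy] := hk y'.
  exact: hy (sK' _ y's) _ Kx ky'.
have xM : normc (f x) <= M.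
  have := fM y ys; have : normc (f y - f x) <= e / 2.
    by apply: cl => //; apply: le_lt_trans yx _; lra.
  have := normcB (f y) (f y - f x).
  have -> : f y - (f y - f x) = f x by ring.
  lra.
have := @patch_close _ _ (fun y => 1 - step (k y) m (sqdist x y / D)) f (f x)
  (e / 2) M (2^-1 ^+ m.+1) (enum_fset s) (ltW (half_power_gt0 _ _)) xM.
have h01 : {in enum_fset s, forall y, 0 <= 1 - step (k y) m (sqdist x y / D) <= 1}.
  move=> y' y's; have /andP[] := step_itv (k y') m (KD _ _ Kx (sK' _ y's)); lra.
have cM : {in enum_fset s, forall y, normc (f y) <= M}.
  by move=> y' y's; have := fM _ y's; lra.
move=> /(_ h01 cM) main; apply: le_trans (main _ _) _.
- move=> y' y's; have [lt2|ge2] := ltP ((k y')%:R * (sqdist x y' / D)) 2.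
    by left; exact: cl.
  by right; have := step_large m (KD _ _ Kx (sK' _ y's)) ge2; lra.
- exists y => //; split; first by apply: cl => //; apply: le_lt_trans yx _; lra.
  by have := step_small m (KD _ _ Kx (sK' _ ys)) yx; lra.
have : 2^-1 ^+ m.+1 <= 2^-1 ^+ m :> R.
  by rewrite exprS; have := half_power_gt0 R m; lra.
have nM : 0 <= (size s)%:R * (2 * M) by rewrite !mulr_ge0.
move=> /(ler_wpM2l nM); lra.
Qed.

End RowVectors.

(** * Scheinberg's theorem on closed subsets of real space *)

Section Carleman.
Variables (R : realType) (N : nat).
Local Notation Y := 'rV[R[i]^o]_N.
Implicit Types (x y : 'rV[R]_N) (S K : set 'rV[R]_N).

Lemma embedB_polydisc (d : R) x y : 0 <= d -> sqdist y x <= d ^+ 2 ->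
  polydisc d (embed y - embed x).
Proof.
move=> d0 yx i; rewrite !mxE -rmorphB normcR.
rewrite -(@ler_pXn2r _ 2) ?nnegrE // real_normK ?num_real //.
apply: le_trans yx; rewrite /sqdist (bigD1 i) //= lerDl.
by apply: sumr_ge0 => l _; exact: sqr_ge0.
Qed.

Lemma embed_polydisc (a : R) x : sqdist x 0 <= a -> polydisc (1 + a) (embed x).
Proof.
move=> xa; have a0 := le_trans (sqdist_ge0 _ _) xa.
have -> : embed x = embed x - embed 0.
  by apply/rowP => i; rewrite !mxE subr0.
by apply: embedB_polydisc; nra.
Qed.

Lemma tame_cont_on S (F : Y -> R[i]) : jet_tame F -> cont_on S (F \o @embed R N).
Proof.
move=> tF x Sx e e0; pose r := 3 + sqdist x 0.
have [M [D jF]] := tF r; pose d := Num.min 1 (e / (`|M| + 1)).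
have M1 : 0 < `|M| + 1 by rewrite ltr_wpDl.
have d0 : 0 < d by rewrite lt_min ltr01 divr_gt0.
apply/near_sqdist; exists (d ^+ 2); first by rewrite exprn_gt0.
move=> y yx _ /=; have xr : polydisc r (embed x).
  by apply: polydisc_le (embed_polydisc (lexx _)); rewrite /r; lra.
have yxd := embedB_polydisc (ltW d0) (ltW yx).
have yr : polydisc r (embed y).
  move=> i; have -> : embed y = embed x + (embed y - embed x) by rewrite addrC subrK.
  rewrite mxE; apply: le_trans (normcD _ _) _.
  have := yxd i; have := embed_polydisc (lexx (sqdist x 0)) i.
  have : d <= 1 by rewrite ge_min lexx.
  by rewrite /r; lra.
have := jet_lipschitz jF xr yr (ltW d0) yxd.
have : d * (`|M| + 1) <= e by rewrite -ler_pdivlMr // ge_min lexx orbT.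
have := ler_norm M; have := normc_ge0 (F (embed y) - F (embed x)); nra.
Qed.

Lemma cont_onB S (f g : 'rV[R]_N -> R[i]) : cont_on S f -> cont_on S g ->
  cont_on S (fun x => f x - g x).
Proof.
move=> hf hg x Sx e e0; have e20 : 0 < e / 2 by rewrite divr_gt0.
apply: filterS2 (hf x Sx _ e20) (hg x Sx _ e20) => y h1 h2 Sy.
have -> : f y - g y - (f x - g x) = (f y - f x) - (g y - g x) by ring.
apply: le_lt_trans (normcB _ _) _; have := h1 Sy; have := h2 Sy; lra.
Qed.

Lemma cont_on_sub S K (f : 'rV[R]_N -> R[i]) : K `<=` S -> cont_on S f -> cont_on K f.
Proof.
move=> KS hf x Kx e e0; apply: filterS (hf x (KS _ Kx) _ e0) => y h /KS.
exact: h.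
Qed.

Definition slice S (a : R) : set 'rV[R]_N := [set x | S x /\ sqdist x 0 <= a].

Lemma slice_compact S a : closed S -> compact (slice S a).
Proof.
move=> Sc; apply: bounded_closed_compact.
  exists (1 + a); split; first exact: num_real.
  move=> b ab x [Sx xa] /=; rewrite /Num.norm /= mx_normrE.
  apply/bigmax_leP; have := embed_polydisc xa.
  have a0 := le_trans (sqdist_ge0 _ _) xa.
  move=> h; split=> [|[i j] _ /=]; first lra.
  have := h j; rewrite !mxE normcR (ord1 i); lra.
move=> x clx; split.
  by apply: Sc => U /clx [y [[Sy _] Uy]]; exists y.
rewrite leNgt; apply/negP => ax.
have ax0 : 0 < sqdist x 0 - a by rewrite subr_gt0.
have cq := tame_cont_on (jet_tame_csqdist 0) (I : setT x) ax0.
have [y [[_ ya]]] := clx _ cq; move=> /(_ I) /=.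
rewrite !csqdist_embed -rmorphB normcR ltr_norml; lra.
Qed.

(** What the construction uses of a positive continuous tolerance. *)
Definition locally_positive_on S (eps : 'rV[R]_N -> R) :=
  forall x, S x -> exists2 c : R, 0 < c & \forall y \near x, S y -> c <= eps y.

Lemma compact_lower_bound S K eps : compact K -> K `<=` S ->
  locally_positive_on S eps -> exists2 c : R, 0 < c & forall x, K x -> c <= eps x.
Proof.
move=> /compact_near_coveringP Kc KS he.
have := Kc nat \oo (fun j x => S x -> 2^-1 ^+ j <= eps x) _.
move=> h; have : \forall j \near \oo, K `<=` (fun x => S x -> 2^-1 ^+ j <= eps x).
  apply: h => x Kx; have [c c0 hc] := he x (KS _ Kx).
  have [m hm] := archimedean_half_power 1 c0.
  exists ([set y | S y -> c <= eps y], [set j | (m <= j)%N]).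
    by split => //; exists m.
  move=> [y j] [/= hy mj Sy]; apply: le_trans (hy Sy); apply: le_trans hm.
  rewrite mul1r -(subnK mj) exprD ler_piMl //.
  by rewrite exprn_ile1 // invf_le1 // ler1n.
case=> j _ /(_ j (leqnn j)) hj; exists (2^-1 ^+ j); first exact: half_power_gt0.
by move=> x Kx; apply: hj => //; exact: KS.
Qed.

(** The condition on [r] says that [8 t], for [t = (z . z) / (4 a)], has size at most
    1/2 on the polydisc of radius [r]; the threshold [t = 1/8] of the cutoff is the
    sphere [|x|^2 = a / 2] inside the old slice [|x|^2 <= a], and [8 t >= 2] off this
    slice. *)
Lemma carleman_step S f eps (F : Y -> R[i]) (a r : R) j :
  closed S -> cont_on S f -> locally_positive_on S eps ->
  jet_tame F -> 0 < a -> 1 <= r -> 36 * N%:R * r ^+ 2 <= a ->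
  (forall x, slice S a x -> normc (F (embed x) - f x) <= eps x / 2) ->
  exists G, [/\ jet_tame G, jet_size r (2^-1 ^+ j) G &
    forall x, slice S (4 * a) x ->
      normc (F (embed x) + G (embed x) - f x) <= eps x / 2].
Proof.
move=> Sc fc epos tF a0 r1 ra Fa.
pose K := slice S (4 * a); have Kc : compact K by exact: slice_compact.
have KS : K `<=` S by move=> x [].
have [c c0 hc] := compact_lower_bound Kc KS epos.
have c40 : 0 < c / 4 by rewrite divr_gt0.
have gc : cont_on K (fun x => f x - F (embed x)).
  apply: cont_onB; first exact: cont_on_sub fc.
  exact: tame_cont_on.
have [p tp hp] := tame_dense Kc (fun x => @proj2 _ _) gc c40.
have [M hM] := tp r; have r0 : 0 <= r by lra.
have M0 := jet_size_ge0 r0 hM.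
have [B [E jB]] := tp (1 + 4 * a).
have gB x : K x -> normc (F (embed x) - f x) <= `|B| + c.
  move=> Kx; rewrite normcC.
  have := hp x Kx; have := jet_value jB (embed_polydisc (proj2 Kx)).
  have := ler_norm B; have := normcB (p (embed x)) (p (embed x) - (f x - F (embed x))).
  have -> : p (embed x) - (p (embed x) - (f x - F (embed x))) = f x - F (embed x) by ring.
  have := normc_ge0 (p (embed x)); lra.
have e1 : 0 < Num.min (2^-1 ^+ j) (c / 4) by rewrite lt_min half_power_gt0.
have [m hm] := archimedean_half_power (M + (`|B| + c)) e1.
have Bc0 : 0 <= `|B| + c by rewrite addr_ge0 // ltW.
have p0 := half_power_gt0 R m.
pose b := 4 * a; have b0 : 0 < b by rewrite mulr_gt0.
pose q (z : Y) := (b^-1)%:C * csqdist 0 z.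
have tq : jet_tame q.
  by apply: jet_tameM; [exact: jet_tame_const|exact: jet_tame_csqdist].
exists (fun z => step 8 m (q z) * p z); split.
- by apply: jet_tameM => //; exact: jet_tame_step.
- have hq : jet_size r (2 * 8%:R)^-1 q.
    apply: jet_size_le (jet_sizeZ _ r0 (jet_size_csqdist0 N r1)).
    have bi0 : 0 <= b^-1 by rewrite invr_ge0 ltW.
    rewrite normcR ger0_norm // [leLHS]mulrC ler_pdivrMr // /b; lra.
  have := jet_sizeM (jet_size_step m r0 (isT : 0 < 8)%N hq) hM; apply: jet_size_le.
  have : (M + (`|B| + c)) * 2^-1 ^+ m <= 2^-1 ^+ j.
    by apply: le_trans hm _; rewrite ge_min lexx.
  nra.
move=> x Kx; have := hc x Kx; have := hp x Kx; have := gB x Kx.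
set t := sqdist x 0 / b.
have t01 : 0 <= t <= 1.
  rewrite divr_ge0 ?sqdist_ge0 ?(ltW b0) //= ler_pdivrMr // mul1r.
  exact: (proj2 Kx).
have -> : q (embed x) = t%:C by rewrite /q csqdist_embed -rmorphM mulrC.
rewrite step_complex; set u := step 8 m t; have /andP[u0 u1] : 0 <= u <= 1 by exact: step_itv.
have -> : F (embed x) + u%:C * p (embed x) - f x =
   u%:C * (p (embed x) - (f x - F (embed x))) + (1 - u%:C) * (F (embed x) - f x).
  by ring.
have := normc_convex (p (embed x) - (f x - F (embed x))) (F (embed x) - f x)
  (step_itv 8 m t01).
rewrite -/u; set v := normc (p _ - _); set w := normc (F _ - _).
have w0 : 0 <= w by exact: normc_ge0.
set lhs := normc _ => h1 h2 h3 h4.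
have h5 : u * v <= u * (c / 4) by rewrite ler_wpM2l.
(* On the old slice the error is a convex combination of [w <= eps x / 2] and
   [v <= c / 4]; on the new shell [1 - u] is so small that [w] does not count. *)
have [xa|ax] := leP (sqdist x 0) a.
  have wx : w <= eps x / 2 by apply: Fa; split => //; case: Kx.
  have h6 : (1 - u) * w <= (1 - u) * (eps x / 2) by rewrite ler_wpM2l //; lra.
  have h7 : 0 <= u * (eps x / 2 - c / 4) by rewrite mulr_ge0 //; lra.
  lra.
have : 1 - 2^-1 ^+ m.+1 <= u.
  apply: step_large => //; rewrite /t mulrA ler_pdivlMr // /b; lra.
have : (M + (`|B| + c)) * 2^-1 ^+ m <= c / 4.
  by apply: le_trans hm _; rewrite ge_min lexx orbT.
rewrite exprS => h6 h7.
have h8 : (1 - u) * w <= 2^-1 ^+ m * (`|B| + c).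
  by apply: ler_pM => //; lra.
have h9 : 0 <= M * 2^-1 ^+ m by rewrite mulr_ge0 // ltW.
have h10 : u * (c / 4) <= c / 4 by rewrite ler_piMl // ltW.
lra.
Qed.

(** The slices grow like [4^j], faster than the squares of the radii [j + 1] of the
    polydiscs on which the [j]-th correction is made smaller than [2^-j]. *)
Theorem carleman_real S f eps : closed S -> cont_on S f ->
  locally_positive_on S eps ->
  exists2 F : Y -> R[i]^o, entire F &
    forall x, S x -> normc (F (embed x) - f x) < eps x.
Proof.
move=> Sc fc epos.
(* The factor meets the condition of [carleman_step] on the radius, as
   [J + 1 <= 2 ^ J]. *)
pose a J : R := (36 * N%:R + 1) * 4 ^+ J.
have a0 J : 0 < a J by rewrite mulr_gt0 ?exprn_gt0 // ltr_wpDl // mulr_ge0.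
pose ok J (F : Y -> R[i]) := jet_tame F /\
  forall x, slice S (a J) x -> normc (F (embed x) - f x) <= eps x / 2.
have [F0 okF0] : exists F, ok 0%N F.
  have Kc := @slice_compact S (a 0%N) Sc.
  have KS : slice S (a 0%N) `<=` S by move=> x [].
  have [c c0 hc] := compact_lower_bound Kc KS epos.
  have c20 : 0 < c / 2 by rewrite divr_gt0.
  have [F tF hF] := tame_dense Kc (fun x => @proj2 _ _) (cont_on_sub KS fc) c20.
  exists F; split => // x Kx; have := hF x Kx; have := hc x Kx; lra.
have /choice [nxt hnxt] : forall JF : nat * (Y -> R[i]), exists G, ok JF.1 JF.2 ->
    jet_size JF.1.+1%:R (2^-1 ^+ JF.1.+1) G /\ jet_tame G /\
    ok JF.1.+1 (fun z => JF.2 z + G z).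
  move=> [J F] /=; have [okF|nok] := pselect (ok J F); last by exists (fun=> 0).
  case: (okF) => tF hF.
  have [||G [tG sG hG]] := @carleman_step S f eps F (a J) J.+1%:R J.+1 Sc fc epos tF (a0 J) _ _ hF.
  - by rewrite ler1n.
  - rewrite /a; have -> : (4 : R) = 2 ^+ 2 by rewrite -natrX.
    rewrite -exprM mulnC exprM.
    have h : (J.+1%:R : R) ^+ 2 <= (2 ^+ J) ^+ 2.
      by apply: lerXn2r; rewrite ?nnegrE ?exprn_ge0 // -natrX ler_nat ltn_expl.
    have n0 : 0 <= (N%:R : R) by [].
    have := ler_wpM2l n0 h; have := exprn_ge0 2 (exprn_ge0 J (ler0n R 2)); lra.
  exists G => _; split => //; split => //; split; first exact: jet_tameD.
  by move=> x; rewrite /a exprS mulrCA; exact: hG.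
pose fix Fs J := if J is J'.+1 then (fun z => Fs J' z + nxt (J', Fs J') z) else F0.
have okFs J : ok J (Fs J).
  by elim: J => [//|J IH]; have [_ [_ h]] := hnxt (J, Fs J) IH.
pose T j := if j is j'.+1 then nxt (j', Fs j') else F0.
have sumT J z : \sum_(j < J.+1) T j z = Fs J z.
  elim: J => [|J IH]; first by rewrite big_ord_recr big_ord0 /= add0r.
  by rewrite big_ord_recr /= IH.
have tT j : jet_tame (T j).
  case: j => [|j]; first by case: okF0.
  by have [_ []] := hnxt (j, Fs j) (okFs j).
have sT r : \forall j \near \oo, jet_size r (2^-1 ^+ j) (T j).
  exists (Num.trunc r).+1 => // -[//|j] /= rj.
  have [h _] := hnxt (j, Fs j) (okFs j).
  apply: jet_size_radius h; apply: ltW; apply: lt_le_trans (truncnS_gt r) _.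
  by rewrite ler_nat.
have [F eF cF] := entire_series tT sT.
exists F => // x Sx.
have ex : 0 < eps x.
  by have [c c0 /nbhs_singleton /(_ Sx)] := epos x Sx; lra.
have ex2 : 0 < eps x / 2 by rewrite divr_gt0.
have /cvg_normcP /(_ _ ex2) [J1 _ hJ1] := cF (embed x).
pose J := maxn J1 (Num.trunc (sqdist x 0)).+1.
have := hJ1 J.+1 (leq_trans (leq_maxl _ _) (leqnSn _)).
rewrite /= sumT; have [_ /(_ x)] := okFs J.
have Ka : slice S (a J) x.
  split => //; apply: ltW; apply: lt_le_trans (truncnS_gt _) _.
  apply: (@le_trans _ _ (J%:R)); first by rewrite ler_nat leq_maxr.
  rewrite /a -[leLHS]mul1r; apply: ler_pM => //.
    by rewrite lerDr mulr_ge0.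
  by rewrite -natrX ler_nat ltnW // ltn_expl.
move=> /(_ Ka) h1 h2; have := normc_tri (Fs J (embed x)) (F (embed x)) (f x).
by rewrite (normcC (F _) (Fs _ _)); lra.
Qed.

End Carleman.

(** * Perturbing the argument of an entire function *)

Lemma differentiable_row (K : numFieldType) (V : normedModType K) N
    (h : 'I_N -> V -> K^o) (v : V) :
  (forall j, differentiable (h j) v) ->
  differentiable (fun u => \row_j h j u : 'rV[K^o]_N) v.
Proof.
move=> dh.
have -> : (fun u => \row_j h j u : 'rV[K^o]_N) =
    \sum_(j < N) (fun u => h j u *: (delta_mx ord0 j : 'rV[K^o]_N)).
  apply: funext => u; rewrite fct_sumE; apply/rowP => j.
  rewrite mxE summxE (bigD1 j) //= !mxE !eqxx mulr1 big1 ?addr0 // => k kj.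
  by rewrite !mxE eqxx /= eq_sym (negPf kj) mulr0.
by apply: differentiable_sum => j; exact: differentiableZl.
Qed.

Section Stability.
Variables (R : realType).

Definition l1norm N (z : 'rV[R[i]^o]_N) : R := \sum_i normc (z ord0 i).

Lemma l1norm_ge0 N (z : 'rV[R[i]^o]_N) : 0 <= l1norm z.
Proof. by apply: sumr_ge0 => i _; exact: normc_ge0. Qed.

Lemma l1norm_tri N (w z z' : 'rV[R[i]^o]_N) :
  l1norm (z - z') <= l1norm (z - w) + l1norm (w - z').
Proof.
rewrite /l1norm -big_split; apply: ler_sum => i _; rewrite !mxE.
exact: normc_tri.
Qed.

Lemma l1normC N (z w : 'rV[R[i]^o]_N) : l1norm (z - w) = l1norm (w - z).
Proof. by apply: eq_bigr => i _; rewrite !mxE normcC. Qed.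

Lemma polydisc_l1norm N (z : 'rV[R[i]^o]_N) d : l1norm z <= d -> polydisc d z.
Proof.
move=> zd i; apply: le_trans zd; rewrite /l1norm (bigD1 i) //= lerDl.
by apply: sumr_ge0 => j _; exact: normc_ge0.
Qed.

Lemma l1norm_polydisc N (z : 'rV[R[i]^o]_N) d : polydisc d z -> l1norm z <= N%:R * d.
Proof.
move=> zd; rewrite -[X in X%:R * _]card_ord -sum1_card natr_sum mulr_suml.
by apply: ler_sum => i _; rewrite mul1r.
Qed.

Lemma near_l1norm N (z : 'rV[R[i]^o]_N) (e : R) : 0 < e ->
  \forall w \near z, l1norm (w - z) < e.
Proof.
move=> e0; have e1 : 0 < e / N.+1%:R by rewrite divr_gt0.
apply: filterS (near_polydisc z e1) => w /l1norm_polydisc h.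
apply: le_lt_trans h _; rewrite mulrA ltr_pdivrMr // mulrC ltr_pM2l //.
by rewrite ltr_nat.
Qed.

Lemma nbhs_l1norm N (z : 'rV[R[i]^o]_N) (P : 'rV[R[i]^o]_N -> Prop) :
  (\forall w \near z, P w) ->
  exists2 e : R, 0 < e & forall w, l1norm (w - z) < e -> P w.
Proof.
move=> /nbhs_polydisc [e e0 h]; exists e => // w /ltW/polydisc_l1norm; exact: h.
Qed.

Lemma lipschitz_within_continuous n (G : set 'rV[R[i]^o]_n)
    (d : 'rV[R[i]^o]_n -> R) (C : R) : 0 < C ->
  (forall z w, d z <= d w + C * l1norm (z - w)) -> {within G, continuous d}.
Proof.
move=> C0 dL; apply: continuous_subspaceT => z.
apply/(@cvgrPdist_lt _ _ _ (nbhs z) (nbhs_filter z) d (d z)) => e e0.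
have eC : 0 < e / C by rewrite divr_gt0.
apply: filterS (near_l1norm z eC) => w; rewrite ltr_pdivlMr // => h.
have := dL z w; have := dL w z; rewrite l1normC (l1normC z w) => h1 h2.
by rewrite ltr_norml; lra.
Qed.

Lemma near_within_continuous_gt n (G : set 'rV[R[i]^o]_n)
    (eps : 'rV[R[i]^o]_n -> R) z :
  {within G, continuous eps} -> G z -> 0 < eps z ->
  \forall w \near z, G w -> eps z / 2 < eps w.
Proof.
move=> /subspace_continuousP h Gz ez.
have e2 : 0 < eps z / 2 by rewrite divr_gt0.
move: (h z Gz).
move/(@cvgrPdist_lt _ _ _ (within G (nbhs z)) (within_filter _ (nbhs_filter z)) eps (eps z)).
move=> /(_ _ e2) near_eps.
have {}near_eps : \forall w \near z, G w -> `|eps z - eps w| < eps z / 2 by [].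
apply: filterS near_eps => w k /k; rewrite ltr_norml => /andP[_ kw]; lra.
Qed.

(** The radius is the distance from [(z, u z)] to the set of the pairs [(z', a)] for which
    [F a] is far from [F (u z')]. A distance is automatically Lipschitz, hence
    continuous; it is positive because no such pair is near [(z, u z)]. *)
Lemma stability_radius n N (G : set 'rV[R[i]^o]_n) (u : 'rV[R[i]^o]_n -> 'rV[R[i]^o]_N)
    (F : 'rV[R[i]^o]_N -> R[i]^o) (eps : 'rV[R[i]^o]_n -> R) :
  (forall z w, l1norm (u z - u w) <= 2 * l1norm (z - w)) ->
  continuous F -> {within G, continuous eps} -> (forall z, G z -> 0 < eps z) ->
  exists d : 'rV[R[i]^o]_n -> R,
    [/\ forall z w, d z <= d w + 3 * l1norm (z - w), forall z, G z -> 0 < d z &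
    forall z a, G z -> l1norm (a - u z) < d z -> normc (F a - F (u z)) < eps z / 2].
Proof.
move=> uL Fc ec epos.
(* 1 is added to the set because there may be no bad pair at all. *)
pose bad z a := G z /\ eps z / 2 <= normc (F a - F (u z)).
pose E z : set R := [set t | t = 1 \/
  exists z' a, bad z' a /\ t = l1norm (z - z') + l1norm (a - u z)].
have E0 z : E z !=set0 by exists 1; left.
have Elb z : has_lbound (E z).
  exists 0 => t [->//|[z' [a [_ ->]]]]; by rewrite addr_ge0 // l1norm_ge0.
have dE z t : E z t -> inf (E z) <= t by move=> h; exact: ge_inf.
exists (fun z => inf (E z)); split.
- move=> z w; rewrite -lerBlDr; apply: lb_le_inf => // t [->|[z' [a [b ->]]]].
    rewrite lerBlDr; have := l1norm_ge0 (z - w); have : inf (E z) <= 1 by apply: dE; left.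
    lra.
  have : inf (E z) <= l1norm (z - z') + l1norm (a - u z).
    by apply: dE; right; exists z', a.
  have := l1norm_tri w z z'; have := l1norm_tri (u w) a (u z).
  have := uL w z; rewrite (l1normC w z); lra.
- move=> z Gz; have ez := epos z Gz.
  have e8 : 0 < eps z / 8 by rewrite divr_gt0.
  have [e1 e10 h1] := nbhs_l1norm (Fc (u z) _ (near_normc (F (u z)) e8)).
  (* A bad pair [(z', a)] with [a] within [e1] of [u z], and [z'] within [e2] and
     [e1 / 2] of [z], would satisfy
     [eps z / 4 < eps z' / 2 <= |F a - F (u z')| < eps z / 4]. *)
  have [e2 e20 h2] := nbhs_l1norm (near_within_continuous_gt ec Gz ez).
  have m0 : 0 < Num.min 1 (Num.min e1 (Num.min e2 (e1 / 2))).
    by rewrite !lt_min ltr01 e10 e20 divr_gt0.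
  apply: lt_le_trans m0 _; apply: lb_le_inf => // t [->|[z' [a [[Gz' b] ->]]]].
    by rewrite ge_min lexx.
  rewrite leNgt; apply/negP; rewrite !lt_min => /and4P[_ k1 k2 k3].
  have p1 := l1norm_ge0 (z - z'); have p2 := l1norm_ge0 (a - u z).
  have q1 : normc (F a - F (u z)) < eps z / 8 by apply: h1; lra.
  have q2 : normc (F (u z') - F (u z)) < eps z / 8.
    by apply: h1; have := uL z' z; rewrite (l1normC z' z); lra.
  have q3 : eps z / 2 < eps z' by apply: h2 => //; rewrite l1normC; lra.
  have := normc_tri (F (u z)) (F a) (F (u z')).
  rewrite (normcC (F (u z)) (F (u z'))); lra.
- move=> z a Gz az; rewrite ltNge; apply/negP => b.
  have : inf (E z) <= l1norm (z - z) + l1norm (a - u z).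
    by apply: dE; right; exists z, a.
  have -> : l1norm (z - z) = 0.
    by rewrite subrr; apply: big1 => i _; rewrite mxE normc0.
  lra.
Qed.

End Stability.

(** * Real coordinates on complex space *)

Section RealCoordinates.
Variables (R : realType) (n : nat).
Local Notation Z := 'rV[R[i]^o]_n.
Implicit Types (z w : Z) (x y : 'rV[R]_(n + n)) (G : set Z).

Definition complexify x : Z :=
  \row_m (x ord0 (lshift n m) +i* x ord0 (rshift n m)).

Definition realify z : 'rV[R]_(n + n) :=
  row_mx (map_mx (@complex.Re R) z) (map_mx (@complex.Im R) z).

Lemma realifyK : cancel realify complexify.
Proof.
move=> z; apply/rowP => m; rewrite !mxE.
rewrite (unsplitK (inl m)) (unsplitK (inr m)) !mxE.
by case: (z ord0 m).
Qed.

Lemma near_complexify x (P : Z -> Prop) :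
  (\forall w \near complexify x, P w) -> \forall y \near x, P (complexify y).
Proof.
move=> /nbhs_polydisc [e e0 h]; apply/near_sqdist.
have e20 : 0 < e / 2 by rewrite divr_gt0.
exists ((e / 2) ^+ 2); first by rewrite exprn_gt0.
move=> y /ltW/(embedB_polydisc (ltW e20)) yx; apply: h => m.
rewrite !mxE; apply: le_trans (normc_Re_Im _) _ => /=.
have := yx (lshift n m); have := yx (rshift n m).
rewrite !mxE -!rmorphB !normcR; lra.
Qed.

Lemma complexify_continuous : continuous complexify.
Proof. by move=> x P; exact: near_complexify. Qed.

Lemma cont_on_complexify G (f : Z -> R[i]^o) : {within G, continuous f} ->
  cont_on (complexify @^-1` G) (f \o complexify).
Proof.
move=> /subspace_continuousP fc x Gx e e0.
apply: (@near_complexify x (fun w => G w -> normc (f w - f (complexify x)) < e)).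
exact: fc Gx _ (near_normc _ e0).
Qed.

(** If [g m] were [Re z_m], this would be [(Re z, Im z)]. *)
Definition lift_coords (g : 'I_n -> Z -> R[i]) z : 'rV[R[i]^o]_(n + n) :=
  \row_j match fintype.split j with
         | inl m => g m z
         | inr m => - 'i * (z ord0 m - g m z) end.

Lemma lift_coords_differentiable (g : 'I_n -> Z -> R[i]^o) z :
  (forall m, entire (g m)) -> differentiable (lift_coords g) z.
Proof.
move=> eg; apply: (@differentiable_row R[i] 'rV[R[i]^o]_n (n + n)
  (fun j z => match fintype.split j with
              | inl m => g m z
              | inr m => - 'i * (z ord0 m - g m z) end)) => j.
case: (fintype.split j) => m; first exact: eg.
apply: (@differentiableM R[i] 'rV[R[i]^o]_n (fun=> - 'i)
  (fun z => z ord0 m - g m z)) => //.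
by apply: differentiableB; [exact: differentiable_coord|exact: eg].
Qed.

Lemma lift_coords_close (g : 'I_n -> Z -> R[i]) z (d : R) :
  (forall m, normc ((complex.Re (z ord0 m))%:C - g m z) <= d) ->
  l1norm (lift_coords g z - embed (realify z)) <= (n + n)%:R * d.
Proof.
move=> gd; apply: l1norm_polydisc => j; rewrite !mxE.
case: (fintype.split j) => m; rewrite !mxE; first by rewrite normcC.
have -> : - 'i * (z ord0 m - g m z) - (complex.Im (z ord0 m))%:C =
    - 'i * ((complex.Re (z ord0 m))%:C - g m z).
  rewrite {1}(complexE (z ord0 m)); have := @sqr_i R; rewrite expr2.
  set j' := 'i; set a := _%:C; set b := (complex.Im _)%:C => jj.
  have -> : - j' * (a + j' * b - g m z) - b =
    - j' * (a - g m z) - (j' * j' + 1) * b by ring.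
  by rewrite jj addNr mul0r subr0.
by rewrite normcM normcN /= expr0n add0r expr1n sqrtr1 mul1r.
Qed.

Lemma realify_lipschitz z w :
  l1norm (embed (realify z) - embed (realify w)) <= 2 * l1norm (z - w).
Proof.
rewrite /l1norm big_split_ord /= mulr_natl mulr2n; apply: lerD;
  apply: ler_sum => m _; rewrite !mxE ?(unsplitK (inl m)) ?(unsplitK (inr m)) !mxE;
  rewrite -rmorphB normcR.
- apply: le_trans (Re_le_normc _); by rewrite raddfB.
- apply: le_trans (Im_le_normc _); by rewrite raddfB.
Qed.

End RealCoordinates.

Theorem proposition2 (R : realType) (n : nat) (G : set 'rV[R[i]^o]_n)
    (G_closed : closed G) :
  tangential_approximation_set G <->
  (forall m : 'I_n,
     tangentially_approximable G
       (fun z : 'rV[R[i]^o]_n => (complex.Re (z ord0 m))%:C)).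
Proof.
split=> [GA m|happrox f fc eps epsc eps0].
  apply: GA; apply: continuous_subspaceT => z.
  apply/(@cvg_normcP _ _ (nbhs z) (nbhs_filter z)) => e e0.
  apply: filterS (near_l1norm z e0) => w /= hw.
  suff : normc ((complex.Re (w ord0 m - z ord0 m))%:C : R[i]) < e.
    by rewrite raddfB rmorphB.
  rewrite normcR; apply: le_lt_trans (Re_le_normc _) _.
  by have := polydisc_l1norm (lexx (l1norm (w - z))) m; rewrite !mxE; lra.
have Sc : closed (@complexify R n @^-1` G).
  by apply: closed_comp => // x _; exact: complexify_continuous.
have epos : locally_positive_on (@complexify R n @^-1` G)
    (fun x => eps (complexify x) / 2).
  move=> x Gx; exists (eps (complexify x) / 4); first by rewrite divr_gt0 ?eps0.
  have := near_complexify (near_within_continuous_gt epsc Gx (eps0 _ Gx)).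
  by apply: filterS => y h Gy; have := h Gy; lra.
have [F eF hF] := carleman_real Sc (cont_on_complexify fc) epos.
have Fc : continuous F by move=> w; exact: differentiable_continuous (eF w).
have [d [dL d0 hd]] := stability_radius (@realify_lipschitz R n) Fc epsc eps0.
(* An error [d] in each of the [n] functions is an error of at most [2 n d] in the
   argument of [F]. *)
pose k : R := 2 * (n + n).+1%:R; have k0 : 0 < k by rewrite mulr_gt0.
have dc : {within G, continuous (fun z => d z / k)}.
  apply: (@lipschitz_within_continuous _ _ _ _ (3 / k)); first by rewrite divr_gt0.
  move=> z w; rewrite mulrAC -mulrDl ler_pM2r ?invr_gt0 //; exact: dL.
have dk0 z : G z -> 0 < d z / k by move=> /d0 ?; rewrite divr_gt0.
have /choice [g hg] : forall m, exists g : 'rV[R[i]^o]_n -> R[i]^o, entire g /\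
    forall z, G z -> `|(complex.Re (z ord0 m))%:C - g z| < (d z / k)%:C.
  by move=> m; have [g] := happrox m _ dc dk0; exists g.
exists (F \o lift_coords g).
  move=> z; apply: differentiable_comp; last exact: eF.
  by apply: lift_coords_differentiable => m; case: (hg m).
move=> z Gz; rewrite normr_normc ltcR /=.
have gz m : normc ((complex.Re (z ord0 m))%:C - g m z) <= d z / k.
  by apply: ltW; rewrite -ltcR -normr_normc; case: (hg m) => _; exact.
have := hd z (lift_coords g z) Gz; have := lift_coords_close gz.
have := hF (realify z); rewrite /= realifyK => /(_ Gz) h1 h2.
have h3 : (n + n)%:R * (d z / k) < d z.
  rewrite mulrA ltr_pdivrMr // mulrC ltr_pM2l ?d0 // /k.
  have : ((n + n)%:R : R) < (n + n).+1%:R by rewrite ltr_nat.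
  have : (0 : R) <= (n + n)%:R by [].
  lra.
move=> /(_ (le_lt_trans h2 h3)) h4.
have := normc_tri (F (embed (realify z))) (f z) (F (lift_coords g z)).
rewrite (normcC (f z) (F (embed _))) (normcC (F (embed _)) (F _)); lra.
Qed.
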